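(* Let $h$ be a Koebe isothermic net, $\varphi\in\mathbb S^1$, and let $c^\varphi$ be an associated congruence of the member $h^\varphi$ of the associated family of $h^*$. Then there is a null congruence $\dot c^\varphi$ with the same center net, i.e. ${\odot\dot c}^\varphi={\odot c}^\varphi$.
   Context: **Lorentz sphere geometry.** $\mathbb R^{2,1}$ is $\mathbb R^3$ with $\langle x,y\rangle=x_1y_1+x_2y_2-x_3y_3$; $|x|=\sqrt{\langle x,x\rangle}$ for spacelike $x$. The Lorentz cross product is defined by $\langle x\times y,z\rangle=\det(x,y,z)$. $\mathbf U_+=\{x:\langle x,x\rangle=-1,\ x_3>0\}$. An oriented sphere has a centre $m$ and a signed radius $R\in\mathbb R$ and underlying set $\{x:\langle x-m,x-m\rangle=R^2\}$; it is an oriented timelike sphere if $R\ne0$ and a null-sphere (with apex $m$) if $R=0$. An oriented isotropic line is a line $\{p+sv\}$ with $\langle v,v\rangle=0$, $v\neq0$, together with an orientation of the direction $v=(v',v_3)$; let $\nu=(Jv'/|v'|,0)$ with $J$ the rotation of $\mathbb R^2$ by $\pi/2$. The oriented sphere $(m,R)$ is in oriented contact with this line if $p-m\in R\nu+\mathbb Rv$; for $R\neq 0$ this means that the line is contained in the sphere with compatible orientation, for $R=0$ that it passes through the apex. Two oriented timelike spheres $(m,R),(m',R')$ are in oriented contact if they touch and $\langle m-m',m-m'\rangle=(R-R')^2$. A spacelike circle is the intersection of a sphere with a spacelike plane. **Combinatorics.** $\mathbb Z^2$ is bipartitioned into black vertices $\mathbb Z^2_\bullet$ ($z_1+z_2$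 even) and white vertices $\mathbb Z^2_\circ$ ($z_1+z_2$ odd). Each face of $\mathbb Z^2$ has two white and two black vertices; two white vertices of a common face are called adjacent. White edges in direction $(1,1)$ are called horizontal, those in direction $(1,-1)$ vertical. **Contact and null congruences.** A contact congruence $c$ assigns to each vertex $v\in\mathbb Z^2$ an oriented timelike sphere or a null-sphere $c(v)$ and to each face $f$ of $\mathbb Z^2$ an oriented isotropic line $c(f)$, such that $c(v)$ is in oriented contact with $c(f)$ whenever $v$ and $f$ are incident. It is a null congruence if $c(w)$ is an oriented timelike sphere for every white vertex $w$ and $c(b)$ is a null-sphere for every black vertex $b$. Its center net is ${\odot c}:\mathbb Z^2\to\mathbb R^{2,1}$, where ${\odot c}(v)$ is the centre of $c(v)$. **S-isothermic and Koebe isothermic nets.** A (spacelike Lorentz) S-isothermic net $h$ assigns to each white vertex $w$ an oriented timelike sphere $h(w)$, to each black vertex $b$ a spacelike circle $h(b)$, and to each face $f$ a point $h(f)$, such that for all faces $f=(w,b,w',b')$ the spheres $h(w),h(w')$ are in oriented contact and the circles $h(b),h(b')$ intersect the two spheres orthogonally in the point $h(f)$. ${\odot h}_\circ(w)$ denotes the centre of $h(w)$. It is a Koebe isothermic net if all circles $h(b)$ lie in $\mathbf U_+$; equivalently, it arises from an orthogonal circle pattern of spacelike circles on $\mathbf U_+$ (a circle at each vertex of $\mathbb Z^2$, adjacent circles orthogonal, the four circles around each face meeting in a point), $h(b)$ being the black circle and $h(w)$ the timelike sphere meeting $\mathbf U_+$ orthogonally in the white circle. $R(w)>0$ denotes the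 (unsigned) radius of $h(w)$; for adjacent $w,w'$ sharing the face $f$ the point $h(f)\in\mathbf U_+$ lies between the centres, so $|{\odot h}_\circ(w')-{\odot h}_\circ(w)|=R(w)+R(w')$. **Associated family.** For a face $f$ with white vertices $w,w'$ let $N=h(f)$, $T=({\odot h}_\circ(w')-{\odot h}_\circ(w))/|{\odot h}_\circ(w')-{\odot h}_\circ(w)|$, $B=T\times N$, $T^\varphi=T\cos\varphi+B\sin\varphi$ and $B^\varphi=-T\sin\varphi+B\cos\varphi$. The net ${\odot h}_\circ^\varphi:\mathbb Z^2_\circ\to\mathbb R^{2,1}$ is defined up to translation by $${\odot h}_\circ^\varphi(w')-{\odot h}_\circ^\varphi(w)=\pm\big(R(w)^{-1}+R(w')^{-1}\big)T^\varphi$$ with $+$ for horizontal and $-$ for vertical white edges (these increments are consistent around every black vertex). For $\varphi=0$ this gives the sphere centres of the Christoffel dual $h^*$. The spheres $h_\circ^\varphi(w)$ are the timelike spheres with centres ${\odot h}_\circ^\varphi(w)$ and radii $R(w)^{-1}$; spheres at adjacent white vertices touch, and they are oriented such that spheres at adjacent white vertices are in oriented contact. **Associated congruences.** At the contact point of the two spheres $h_\circ^\varphi(w),h_\circ^\varphi(w')$ at a face $f$ there are exactly two isotropic lines contained in both spheres, with directions $N\pm B^\varphi$. For a black vertex $b$ with adjacent white vertices $w_1,\dots,w_4$ in cyclic order, let $f_i$ be the face containing $b,w_i,w_{i+1}$ and let $G^\varphi_{i,\pm}$ be the line at $f_i$ with direction $N\pm B^\varphi$, computed with $T$ pointing from $w_i$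 to $w_{i+1}$. The four lines $G^\varphi_{1,+},G^\varphi_{2,-},G^\varphi_{3,+},G^\varphi_{4,-}$ lie in a common sphere of radius $\sin\varphi$, and so do $G^\varphi_{1,-},G^\varphi_{2,+},G^\varphi_{3,-},G^\varphi_{4,+}$. Choosing one of these two spheres (and quadruples of lines) at one black vertex determines a consistent choice at all black vertices; the two resulting contact congruences, with $h_\circ^\varphi$ at the white vertices, the chosen spheres at the black vertices and the chosen lines at the faces, are the associated congruences. *)

(* Defs.v *)
From mathcomp Require Import all_boot all_order all_algebra.
From mathcomp Require Import classical_sets reals trigo.
From mathcomp Require Import ring.
Set Implicit Arguments.
Unset Strict Implicit.
Unset Printing Implicit Defensive.
Import Order.TTheory GRing.Theory Num.Theory.
Local Open Scope classical_set_scope.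
Local Open Scope ring_scope.

Section Lorentz.
Variable R : realType.
Notation V := 'rV[R]_3.

Definition mkvec (a b c : R) : V := \row_(j < 3) nth 0 [:: a; b; c] j.

Definition lip (x y : V) : R := x 0 0 * y 0 0 + x 0 1 * y 0 1 - x 0 2 * y 0 2.

(* Only meaningful for spacelike vectors, i.e. when 0 < lip x x. *)
Definition lnorm (x : V) : R := Num.sqrt (lip x x).

Definition lcross (x y : V) : V :=
  mkvec (x 0 1 * y 0 2 - x 0 2 * y 0 1)
        (x 0 2 * y 0 0 - x 0 0 * y 0 2)
        (x 0 1 * y 0 0 - x 0 0 * y 0 1).

(* The defining property of the Lorentz cross product. *)
Lemma lcrossE (x y z : V) :
  lip (lcross x y) z = \det (\matrix_(i < 3) nth 0 [:: x; y; z] i).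
Proof.
pose g (v : V) n : R := v 0 (inord n).
have E (v : V) (i : 'I_3) : v 0 i = g v i by rewrite /g inord_val.
rewrite (expand_det_row _ 0) !big_ord_recl big_ord0 /cofactor.
rewrite !(expand_det_row _ 0) !big_ord_recl !big_ord0 /cofactor !det_mx11.
rewrite /lip !mxE /=.
by rewrite ![x 0 _]E ![y 0 _]E ![z 0 _]E /= /bump /=; ring.
Qed.

Definition Uplus : set V := [set x | lip x x = -1 /\ 0 < x 0 2].

(* The radius is signed; the sphere is timelike if its radius is nonzero and
   a null-sphere, with apex its centre, otherwise. *)
Record osphere := OSphere { centre : V; radius : R }.

Definition timelike (S : osphere) : Prop := radius S <> 0.
Definition null_sphere (S : osphere) : Prop := radius S = 0.

Definition sphere_points (S : osphere) : set V :=
  [set x | lip (x - centre S) (x - centre S) = radius S ^+ 2].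

(* x is a common point with common tangent plane: the normals x - centre S
   and x - centre S' are parallel.  Meant for timelike spheres. *)
Definition touch_at (S S' : osphere) (x : V) : Prop :=
  [/\ sphere_points S x, sphere_points S' x &
      exists k : R, x - centre S' = k *: (x - centre S)].

Definition sphere_contact (S S' : osphere) : Prop :=
  (exists x, touch_at S S' x) /\
  lip (centre S - centre S') (centre S - centre S')
    = (radius S - radius S') ^+ 2.

Definition line_points (p v : V) : set V := [set p + s *: v | s in [set: R]].

(* lpoint is any point of the line; ldir matters up to a positive factor. *)
Record oline := OLine {
  lpoint : V;
  ldir : V;
  ldir_neq0 : ldir <> 0;
  ldir_isotropic : lip ldir ldir = 0 }.

Definition oline_points (l : oline) : set V := line_points (lpoint l) (ldir l).

(* nu = (J v' / |v'|, 0), where v = (v', v_3), J is the rotation by pi/2, and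
   |.| is the Euclidean norm of the plane. *)
Definition nu (v : V) : V :=
  (Num.sqrt (v 0 0 ^+ 2 + v 0 1 ^+ 2))^-1 *: mkvec (- v 0 1) (v 0 0) 0.

Definition line_contact (S : osphere) (l : oline) : Prop :=
  exists t : R, lpoint l - centre S = radius S *: nu (ldir l) + t *: ldir l.

Definition plane_points (p n : V) : set V := [set x | lip (x - p) n = 0].

(* The intersection of a sphere with a spacelike plane (one with timelike
   normal), not reduced to a point. *)
Record spcircle := SpCircle {
  csphere : osphere;
  cpoint : V;
  cnormal : V;
  cnormal_timelike : lip cnormal cnormal < 0;
  cnondegenerate : exists x y : V,
    [/\ x <> y, (sphere_points csphere `&` plane_points cpoint cnormal) x
      & (sphere_points csphere `&` plane_points cpoint cnormal) y] }.

Definition circle_points (C : spcircle) : set V :=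
  sphere_points (csphere C) `&` plane_points (cpoint C) (cnormal C).

Definition circle_tangent (C : spcircle) (x u : V) : Prop :=
  lip u (cnormal C) = 0 /\ lip u (x - centre (csphere C)) = 0.

(* The normal x - centre S of S at x is tangent to C. *)
Definition circle_sphere_orthogonal_at (C : spcircle) (S : osphere) (x : V) :
    Prop :=
  [/\ circle_points C x, sphere_points S x
    & circle_tangent C x (x - centre S)].

(* The normal of Uplus at x is x. *)
Definition meets_Uplus_orthogonally_in (S : osphere) (C : spcircle) : Prop :=
  circle_points C = sphere_points S `&` Uplus /\
  forall x, circle_points C x -> lip (x - centre S) x = 0.

(* Faces of Z^2 are indexed by their lower left vertex. *)
Definition vertex : Type := (int * int)%type.
Definition face : Type := (int * int)%type.

Definition black (v : vertex) : bool := (2 %| v.1 + v.2)%Z.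
Definition white (v : vertex) : bool := ~~ black v.

Definition incident (v : vertex) (f : face) : bool :=
  (v - f : vertex) \in [:: (0, 0); (1, 0); (1, 1); (0, 1)].

Definition white_edge (f : face) (w w' : vertex) : bool :=
  [&& white w, white w', incident w f, incident w' f & w != w'].

Definition horizontal (w w' : vertex) : bool :=
  (w' - w == ((1, 1) : vertex)) || (w - w' == ((1, 1) : vertex)).

Definition edge_sign (w w' : vertex) : R := if horizontal w w' then 1 else -1.

(* The white vertices adjacent to b in counterclockwise order, indexed by Z/4;
   bface b k contains b, bwhite b k and bwhite b (k + 1). *)
Definition bwhite (b : vertex) (k : 'I_4) : vertex :=
  b + nth 0 [:: (1, 0); (0, 1); (-1, 0); (0, -1)] k.
Definition bface (b : vertex) (k : 'I_4) : face :=
  b + nth 0 [:: (0, 0); (-1, 0); (-1, -1); (0, -1)] k.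

Record congruence := Congruence {
  csph : vertex -> osphere;
  cline : face -> oline }.

Definition contact_congruence (c : congruence) : Prop :=
  forall v f, incident v f -> line_contact (csph c v) (cline c f).

Definition null_congruence (c : congruence) : Prop :=
  [/\ contact_congruence c,
      forall w, white w -> timelike (csph c w)
    & forall b, black b -> null_sphere (csph c b)].

Definition center_net (c : congruence) : vertex -> V :=
  fun v => centre (csph c v).

(* hsphere and hcircle are only relevant at white, resp. black, vertices. *)
Record snet := SNet {
  hsphere : vertex -> osphere;
  hcircle : vertex -> spcircle;
  hpoint : face -> V }.

Definition S_isothermic (h : snet) : Prop :=
  [/\ forall w, white w -> timelike (hsphere h w),
      forall f w w', white_edge f w w' ->
        sphere_contact (hsphere h w) (hsphere h w')
    & forall f w b, white w -> black b -> incident w f -> incident b f ->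
        circle_sphere_orthogonal_at (hcircle h b) (hsphere h w) (hpoint h f)].

(* h comes from an orthogonal pattern of spacelike circles on Uplus, in which
   touching white circles touch from outside (last clause). *)
Definition Koebe (h : snet) : Prop :=
  [/\ S_isothermic h,
      forall b, black b -> circle_points (hcircle h b) `<=` Uplus,
      forall w, white w ->
        exists C, meets_Uplus_orthogonally_in (hsphere h w) C
    & forall f w w', white_edge f w w' -> exists t : R, 0 < t < 1 /\
        hpoint h f =
          (1 - t) *: centre (hsphere h w) + t *: centre (hsphere h w')].

Definition hradius (h : snet) (w : vertex) : R := `|radius (hsphere h w)|.

Section Frame.
Variables (h : snet) (f : face) (w w' : vertex).

Definition frameN : V := hpoint h f.
Definition frameT : V :=
  let e := centre (hsphere h w') - centre (hsphere h w) in (lnorm e)^-1 *: e.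
Definition frameB : V := lcross frameT frameN.
Definition frameTphi (phi : R) : V := cos phi *: frameT + sin phi *: frameB.
Definition frameBphi (phi : R) : V := - sin phi *: frameT + cos phi *: frameB.

End Frame.

(* hphi is only relevant at white vertices; its centres are determined up to
   translation, its orientations up to a global change. *)
Definition associated_member (h : snet) (phi : R) (hphi : vertex -> osphere) :
    Prop :=
  [/\ forall f w w', white_edge f w w' ->
        centre (hphi w') - centre (hphi w)
          = (edge_sign w w' * ((hradius h w)^-1 + (hradius h w')^-1))
              *: frameTphi h f w w' phi,
      forall w, white w -> `|radius (hphi w)| = (hradius h w)^-1
    & forall f w w', white_edge f w w' -> sphere_contact (hphi w) (hphi w')].

(* The signs of the directions N +- B^phi alternate around b; s selects one of
   the two quadruples.  Since c is a contact congruence, the sphere at b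
   contains the four lines. *)
Definition associated_congruence (h : snet) (phi : R)
    (hphi : vertex -> osphere) (c : congruence) : Prop :=
  [/\ contact_congruence c,
      forall w, white w -> csph c w = hphi w,
      forall b, black b -> `|radius (csph c b)| = `|sin phi|
    & forall b, black b -> exists s : bool, forall k : 'I_4,
        let f := bface b k in
        let w := bwhite b k in
        let w' := bwhite b (k + 1) in
        exists x : V, touch_at (hphi w) (hphi w') x /\
          oline_points (cline c f) =
            line_points x
              (frameN h f + (-1) ^+ (s + k)%N *: frameBphi h f w w' phi)].

End Lorentz.

(* Main.v *)
Require Import Defs.
From mathcomp Require Import all_boot all_order all_algebra.
From mathcomp Require Import classical_sets reals trigo.
From mathcomp Require Import ring lra zify.
Set Implicit Arguments.
Unset Strict Implicit.
Unset Printing Implicit Defensive.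
Import Order.TTheory GRing.Theory Num.Theory.
Local Open Scope ring_scope.

(** Decreasing all signed radii by the same amount r, and moving each line by
    - r nu, preserves oriented contact and the centres.  So it suffices that all
    black spheres of c have the same signed radius r: then they become
    null-spheres, while the white spheres stay timelike because their radii
    satisfy 1/R > 1 >= |sin phi| = |r|.

    For an isotropic line x + R u with direction v, oriented contact with
    (m, rho) reads (x - m) x u = rho sg(v_3) u, as nu x v = sg(v_3) v.  If
    x_0 + R u_0 and x_2 + R u_2 are lines at two opposite faces around a black
    vertex b, pairing their contact equations with u_2 and u_0 eliminates the
    centre of c(b), and gives det(x_0 - x_2, u_0, u_2) = 2 r sg(v_3) <u_0, u_2>.
    The contact points x_k are computed in terms of the black circle of h, in
    whose plane N_k = a n + E_k with n the unit normal, and the determinant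
    turns out to be +- 2 sin phi <u_0, u_2>, with the sign of the white edge at
    the face.  Thus r is determined by the face and its line alone, and so it
    agrees at the two black vertices of every face. *)

(** * Algebra of the Lorentz product and cross product *)

Section LorentzAlgebra.
Variable R : realType.
Implicit Types (k : R) (x y z n : 'rV[R]_3).

Lemma vec3P x y : x 0 0 = y 0 0 -> x 0 1 = y 0 1 -> x 0 2 = y 0 2 -> x = y.
Proof.
move=> h0 h1 h2; apply/rowP => -[[|[|[|//]]] ij].
- by rewrite (_ : Ordinal ij = 0) //; apply/val_inj.
- by rewrite (_ : Ordinal ij = 1) //; apply/val_inj.
- by rewrite (_ : Ordinal ij = 2) //; apply/val_inj.
Qed.

Lemma lipC x y : lip x y = lip y x.
Proof. by rewrite /lip; ring. Qed.

Lemma lipDl x y z : lip (x + y) z = lip x z + lip y z.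
Proof. by rewrite /lip !mxE; ring. Qed.

Lemma lipNl x z : lip (- x) z = - lip x z.
Proof. by rewrite /lip !mxE; ring. Qed.

Lemma lipZl k x z : lip (k *: x) z = k * lip x z.
Proof. by rewrite /lip !mxE; ring. Qed.

Lemma lipDr x y z : lip z (x + y) = lip z x + lip z y.
Proof. by rewrite lipC lipDl !(lipC _ z). Qed.

Lemma lipNr x z : lip z (- x) = - lip z x.
Proof. by rewrite lipC lipNl (lipC x). Qed.

Lemma lipZr k x z : lip z (k *: x) = k * lip z x.
Proof. by rewrite lipC lipZl (lipC x). Qed.

Definition lipE := (lipDl, lipDr, lipNl, lipNr, lipZl, lipZr).

Lemma lcrossDl x y z : lcross (x + y) z = lcross x z + lcross y z.
Proof. by apply: vec3P; rewrite !mxE /=; ring. Qed.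

Lemma lcrossNl x z : lcross (- x) z = - lcross x z.
Proof. by apply: vec3P; rewrite !mxE /=; ring. Qed.

Lemma lcrossZl k x z : lcross (k *: x) z = k *: lcross x z.
Proof. by apply: vec3P; rewrite !mxE /=; ring. Qed.

Lemma lcrossC x y : lcross x y = - lcross y x.
Proof. by apply: vec3P; rewrite !mxE /=; ring. Qed.

Lemma lcrossDr x y z : lcross z (x + y) = lcross z x + lcross z y.
Proof. by apply: vec3P; rewrite !mxE /=; ring. Qed.

Lemma lcrossNr x z : lcross z (- x) = - lcross z x.
Proof. by apply: vec3P; rewrite !mxE /=; ring. Qed.

Lemma lcrossZr k x z : lcross z (k *: x) = k *: lcross z x.
Proof. by apply: vec3P; rewrite !mxE /=; ring. Qed.

Lemma lcrossxx x : lcross x x = 0.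
Proof. by apply: vec3P; rewrite !mxE /=; ring. Qed.

Definition lcrossDE :=
  (lcrossDl, lcrossDr, lcrossNl, lcrossNr, lcrossZl, lcrossZr, lcrossxx).

(* The sign is opposite to the Euclidean one. *)
Lemma lcross_lcross x y z :
  lcross x (lcross y z) = lip x y *: z - lip x z *: y.
Proof. by rewrite /lip; apply: vec3P; rewrite !mxE /=; ring. Qed.

Lemma lip_lcrossl x y : lip (lcross x y) x = 0.
Proof. by rewrite /lip !mxE /=; ring. Qed.

Lemma lip_lcrossr x y : lip (lcross x y) y = 0.
Proof. by rewrite /lip !mxE /=; ring. Qed.

Lemma lip_lcross_swap x y z : lip (lcross x y) z = - lip (lcross x z) y.
Proof. by rewrite /lip !mxE /=; ring. Qed.

Lemma lip_lcross_lcross x y :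
  lip (lcross x y) (lcross x y) = lip x y ^+ 2 - lip x x * lip y y.
Proof. by rewrite /lip !mxE /=; ring. Qed.

Lemma lcross_cramer x y z w :
  lip (lcross x y) z *: w = lip w (lcross y z) *: x + lip w (lcross z x) *: y
    + lip w (lcross x y) *: z.
Proof. by rewrite /lip; apply: vec3P; rewrite !mxE /=; ring. Qed.

(** Substituting [n_2 x_2 = n_0 x_0 + n_1 x_1], Lagrange's identity makes the difference of the two
    sides the square of [n_0 x_1 - n_1 x_0]. So the form is positive definite on the orthogonal
    complement of a timelike vector. *)
Lemma orthogonal_timelike_le n x : lip n n < 0 -> lip n x = 0 ->
  let d := n 0 2 ^+ 2 - n 0 0 ^+ 2 - n 0 1 ^+ 2 in
  0 < d /\ d * (x 0 0 ^+ 2 + x 0 1 ^+ 2) <= n 0 2 ^+ 2 * lip x x.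
Proof.
rewrite /lip -!expr2.
move: (n 0 0) (n 0 1) (n 0 2) (x 0 0) (x 0 1) (x 0 2) => a b c p q r h1 h2.
split; first by lra.
have cr : (c * r) ^+ 2 = (a * p + b * q) ^+ 2 by congr (_ ^+ 2); lra.
rewrite -subr_ge0.
suff -> : c ^+ 2 * (p ^+ 2 + q ^+ 2 - r ^+ 2)
   - (c ^+ 2 - a ^+ 2 - b ^+ 2) * (p ^+ 2 + q ^+ 2) = (a * q - b * p) ^+ 2.
  exact: sqr_ge0.
by ring: cr.
Qed.

Lemma orthogonal_timelike_eq0 n x :
  lip n n < 0 -> lip n x = 0 -> lip x x = 0 -> x = 0.
Proof.
move=> n2 nx x2; have [d0] := orthogonal_timelike_le n2 nx.
rewrite x2 mulr0 pmulr_rle0// => pq.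
have [p2 q2] := (sqr_ge0 (x 0 0), sqr_ge0 (x 0 1)).
have p0 : x 0 0 = 0 by apply/eqP; rewrite -sqrf_eq0; apply/eqP; lra.
have q0 : x 0 1 = 0 by apply/eqP; rewrite -sqrf_eq0; apply/eqP; lra.
apply: vec3P; rewrite mxE //; apply/eqP; rewrite -sqrf_eq0.
by move/eqP: x2; rewrite /lip p0 q0 !mul0r add0r sub0r oppr_eq0 -expr2.
Qed.

End LorentzAlgebra.

(** * The frame T, B, N rotated by phi, and its isotropic directions *)

Section RotatedFrame.
Variables (R : realType) (N T : 'rV[R]_3).
Hypotheses (NN : lip N N = -1) (TT : lip T T = 1) (TN : lip T N = 0).
Let B := lcross T N.

Lemma lcross_TB : lcross T B = N.
Proof. by rewrite lcross_lcross TT TN scale1r scale0r subr0. Qed.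

Lemma lcross_NB : lcross N B = T.
Proof.
by rewrite lcross_lcross NN (lipC N) TN scale0r scaleN1r opprK add0r.
Qed.

Lemma lip_BB : lip B B = 1.
Proof. by rewrite lip_lcross_lcross TN TT NN; ring. Qed.

Lemma lip_BN : lip B N = 0. Proof. exact: lip_lcrossr. Qed.
Lemma lip_BT : lip B T = 0. Proof. exact: lip_lcrossl. Qed.

Variables c s : R.
Hypothesis cs : c ^+ 2 + s ^+ 2 = 1.
Let s2 : s ^+ 2 = 1 - c ^+ 2. Proof. by rewrite -cs addrAC subrr add0r. Qed.
Let Tp := c *: T + s *: B.
Let Bp := - s *: T + c *: B.

Lemma lip_rotT : lip Tp Tp = 1.
Proof.
by rewrite !lipE TT lip_BB (lipC T) lip_BT; ring: s2.
Qed.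

Variable d : R.
Hypothesis d2 : d ^+ 2 = 1.
Let u := N + d *: Bp.

Lemma lip_isotropic_dir : lip u u = 0.
Proof.
rewrite !lipE TT NN lip_BB lip_BN lip_BT !(lipC _ B) lip_BN lip_BT (lipC N) TN.
by ring: d2 s2.
Qed.

Lemma isotropic_dir_neq0 : u != 0.
Proof.
apply/eqP => u0; have /eqP : lip u N = 0 by rewrite u0 /lip !mxE; ring.
rewrite !lipE NN lip_BN TN !mulr0 addr0 mulr0 addr0.
by rewrite oppr_eq0 oner_eq0.
Qed.

(** The isotropic direction is an eigenvector of the cross product with [Tp]. Since the white
    centres lie along [Tp] from the contact point, this reduces the contact of a white sphere with
    the line to a scalar equation. *)
Lemma lcross_rotT_dir : lcross Tp u = d *: u.
Proof.
rewrite !lcrossDE lcross_TB (lcrossC B T) lcross_TB (lcrossC B N) lcross_NB.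
rewrite /u /Bp /B; move: (lcross T N) => B'; apply/rowP => j; rewrite !mxE.
by ring: d2 s2.
Qed.

End RotatedFrame.

(** * Frames tangent to a circle on Uplus *)

Section TangentFrame.
Variable R : realType.
Implicit Types N T n : 'rV[R]_3.

(* N is a point of the circle cut out of Uplus by the plane <x, n> = -a, and T
   is a unit tangent of this circle at N. *)
Definition tangent_frame n a N T :=
  [/\ lip N N = -1, lip T T = 1, lip T N = 0, lip N n = - a & lip T n = 0].

(* Up to a sign depending on the orientation of T, the Euclidean radius of the
   circle. *)
Definition sgradius n N T := - lip (lcross T N) n.

Variables (n : 'rV[R]_3) (a : R) (N T : 'rV[R]_3).
Hypotheses (nn : lip n n = -1) (F : tangent_frame n a N T).
Local Notation l := (sgradius n N T).
Local Notation B := (lcross T N).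

(** This is the expansion of [n] in the orthonormal frame T, N, B, in which N is timelike. *)
Lemma tangent_frame_normal : n = a *: N - l *: B.
Proof.
case: F => NN TT TN Nn Tn.
have := lcross_cramer T N B n; rewrite (lip_BB NN TT TN) scale1r.
rewrite (lcross_NB NN TN) (lcrossC B T) (lcross_TB TT TN) !lipE (lipC n T) Tn.
by rewrite (lipC n N) Nn (lipC n B) /sgradius scale0r add0r opprK scaleNr opprK.
Qed.

(** With [sgradius_T], this replaces T and B, once scaled by [l], by expressions in N and [n] alone,
    so that tangents can be compared through their points. *)
Lemma sgradius_B : l *: B = a *: N - n.
Proof. by rewrite {2}tangent_frame_normal opprB addrC subrK. Qed.

Lemma sgradius_T : l *: T = lcross n N.
Proof.
case: F => NN TT TN Nn Tn.
rewrite [X in lcross X N]tangent_frame_normal !lcrossDE.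
rewrite (lcrossC (lcross T N)) (lcross_NB NN TN).
by rewrite scaler0 add0r scalerN opprK.
Qed.

(** The circle thus determines [l] up to sign; the sign records the sense in which T runs along
    it. *)
Lemma sgradius_sqr : l ^+ 2 = a ^+ 2 - 1.
Proof.
case: F => NN TT TN Nn Tn.
have : lip (l *: B) (l *: B) = lip (a *: N - n) (a *: N - n).
  by rewrite sgradius_B.
rewrite !lipE (lip_BB NN TT TN) nn NN (lipC n N) Nn => e.
by ring: e.
Qed.

End TangentFrame.

(** * Chords between two contact points of one circle *)

Section Chords.
Variables (R : realType) (n : 'rV[R]_3) (a c s : R).
Hypotheses (nn : lip n n = -1) (cs : c ^+ 2 + s ^+ 2 = 1).
Implicit Types N T : 'rV[R]_3.
Let s2 : s ^+ 2 = 1 - c ^+ 2. Proof. by rewrite -cs addrAC subrr add0r. Qed.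
Let n_lt0 : lip n n < 0. Proof. by rewrite nn oppr_lt0 ltr01. Qed.
Local Notation l := (sgradius n).
Local Notation rotT N T := (c *: T + s *: lcross T N).
Local Notation frame := (tangent_frame n a).

Lemma chord_normal N0 T0 N1 T1 :
  frame N0 T0 -> frame N1 T1 -> lip n (N1 - N0) = 0.
Proof.
by case=> _ _ _ + _ [_ _ _ + _] => h0 h1; rewrite lipC !lipE h0 h1 subrr.
Qed.

Lemma chord_eq0 N0 T0 N1 T1 : frame N0 T0 -> frame N1 T1 ->
  lip (N1 - N0) (N1 - N0) = 0 -> N1 = N0.
Proof.
move=> F0 F1 W0; apply/eqP; rewrite -subr_eq0; apply/eqP.
exact: (orthogonal_timelike_eq0 n_lt0 (chord_normal F0 F1) W0).
Qed.

(** For tangents of opposite sense, [sgradius_T] turns the chord relation into [l W = - r (n x W)]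
    with [W = N1 - N0]. Pairing with W gives [<W, W> = 0], and W is orthogonal to the timelike
    [n]. *)
Lemma tangent_chord_flip N0 T0 N1 T1 r : frame N0 T0 -> frame N1 T1 ->
  r != 0 -> N1 - N0 = r *: (T0 + T1) -> l N0 T0 != 0 ->
  l N1 T1 = - l N0 T0 -> N1 = N0 /\ T1 = - T0.
Proof.
move=> F0 F1 r0 e l0 el.
have N10 : N1 = N0.
  apply: (chord_eq0 F0 F1); set W := N1 - N0.
  have lW : l N0 T0 *: W = - r *: lcross n W.
    rewrite /W {1}e scalerA mulrC -scalerA scalerDr (sgradius_T F0).
    rewrite -[l N0 T0]opprK -el scaleNr (sgradius_T F1) lcrossDr lcrossNr.
    by rewrite scaleNr -scalerN opprB.
  have /eqP : l N0 T0 * lip W W = 0.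
    by rewrite -lipZl lW lipZl lip_lcrossr mulr0.
  by rewrite mulf_eq0 (negPf l0) => /eqP.
split=> //; apply/eqP; rewrite -addr_eq0 addrC.
by move/eqP: e; rewrite N10 subrr eq_sym scaler_eq0 (negPf r0).
Qed.

Lemma tangent_chord_neq N0 T0 N1 T1 r : frame N0 T0 -> frame N1 T1 ->
  r != 0 -> N1 - N0 = r *: (T0 + T1) -> l N0 T0 != 0 -> l N1 T1 = l N0 T0 ->
  N1 <> N0.
Proof.
move=> F0 F1 r0 e l0 el N10.
have T10 : T1 = T0.
  by apply: (scalerI l0); rewrite -{1}el !(sgradius_T F0, sgradius_T F1) N10.
move/eqP: e; rewrite N10 T10 subrr eq_sym scaler_eq0 (negPf r0) /=.
rewrite -mulr2n -scaler_nat scaler_eq0 pnatr_eq0 /= => /eqP T00.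
case: F0 => _ + _ _ _; rewrite T00 /lip !mxE => /eqP.
by rewrite !mulr0 addr0 subrr eq_sym oner_eq0.
Qed.

(** Up to sign, the vector scaled by [l ^+ 2] is the difference of the two contact points on a white
    sphere of radius [r^-1]. The chord relation trades [r^-1 (N0 - N1)] for [- (T0 + T1)], so [r]
    drops out and only [N0 + N1] remains. *)
Lemma tangent_chord_rotT N0 T0 N1 T1 r : frame N0 T0 -> frame N1 T1 ->
  r != 0 -> N1 - N0 = r *: (T0 + T1) -> l N1 T1 = l N0 T0 ->
  l N0 T0 ^+ 2 *: (r^-1 *: (rotT N0 T0 - rotT N1 T1))
    = c *: (N0 + N1 - (a *+ 2) *: n) - (a * s) *: lcross n (N0 + N1).
Proof.
move=> F0 F1 r0 e el.
set L := l N0 T0.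
have lT0 : L *: T0 = lcross n N0 by exact: (sgradius_T F0).
have lT1 : L *: T1 = lcross n N1 by rewrite -[L]el; exact: (sgradius_T F1).
have lB0 : L *: lcross T0 N0 = a *: N0 - n by exact: (sgradius_B F0).
have lB1 : L *: lcross T1 N1 = a *: N1 - n.
  by rewrite -[L]el; exact: (sgradius_B F1).
have S : L *: (T0 + T1) = lcross n (N0 + N1).
  by rewrite scalerDr lT0 lT1 lcrossDr.
have Ne : r^-1 *: (N0 - N1) = - (T0 + T1).
  by rewrite -opprB e scalerN scalerA mulVf// scale1r.
have dT : L ^+ 2 *: (r^-1 *: (T0 - T1)) = N0 + N1 - (a *+ 2) *: n.
  rewrite expr2 -scalerA [L *: (r^-1 *: _)]scalerA mulrC -scalerA.
  rewrite (scalerBr L) lT0 lT1 -lcrossNr -lcrossDr -lcrossZr Ne.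
  rewrite -lcrossZr scalerN S lcrossNr lcross_lcross nn !lipE.
  case: F0 F1 => _ _ _ + _ [_ _ _ + _]; rewrite (lipC N0) (lipC N1) => -> ->.
  by apply/rowP => j; rewrite !mxE; ring.
have dB : L ^+ 2 *: (r^-1 *: (lcross T0 N0 - lcross T1 N1))
    = - a *: lcross n (N0 + N1).
  rewrite expr2 -scalerA [L *: (r^-1 *: _)]scalerA mulrC -scalerA.
  rewrite (scalerBr L) lB0 lB1 opprB addrA subrK -scalerBr.
  rewrite [r^-1 *: _]scalerA mulrC -scalerA Ne scalerA mulrC -scalerA.
  by rewrite scalerN S scalerN scaleNr.
have -> : (a * s) *: lcross n (N0 + N1) = - (s *: (- a *: lcross n (N0 + N1))).
  by rewrite scalerA mulrN scaleNr opprK mulrC.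
rewrite -dB -dT opprK.
move: (lcross T0 N0) (lcross T1 N1) => B0 B1.
by apply/rowP => j; rewrite !mxE; ring.
Qed.

Variable d : R.
Hypothesis d2 : d ^+ 2 = 1.
Local Notation dir N T := (N + d *: (- s *: T + c *: lcross T N)).

Lemma sgradius_dir N T : frame N T ->
  l N T *: dir N T =
    (l N T + d * c * a) *: N - (d * c) *: n - (d * s) *: lcross n N.
Proof.
move=> F; rewrite -(sgradius_T F); have := sgradius_B F.
move: (l N T) (lcross T N) => L B /rowP e; apply/rowP => j.
by have := e j; rewrite !mxE => {}e; ring: e.
Qed.

Section TwoFrames.
Variables N0 T0 N2 T2 : 'rV[R]_3.
Hypotheses (F0 : frame N0 T0) (F2 : frame N2 T2).
Hypotheses (el : l N2 T2 = l N0 T0) (l0 : l N0 T0 != 0).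
Local Notation L := (l N0 T0).
Let W := N0 - N2.
(** By [sgradius_dir], [al] and [- ga] are the coefficients of N and [n x N] in the scaled
    direction. Hence [U0 - U2] arises from W by a scaled rotation of the plane orthogonal to [n]. *)
Let al := L + d * c * a.
Let ga := d * s.
Let U0 := L *: dir N0 T0.
Let U2 := L *: dir N2 T2.

Let nW : lip n W = 0. Proof. exact: chord_normal F2 F0. Qed.

Let U02 : U0 - U2 = al *: W - ga *: lcross n W.
Proof.
rewrite /U0 /U2 -{2}el !sgradius_dir// el /W lcrossDr lcrossNr /al /ga.
move: (lcross _ _) (lcross _ _) => x y.
by apply/rowP => j; rewrite !mxE; ring.
Qed.

Let lip_UU : lip (U0 - U2) (U0 - U2) = (al ^+ 2 + ga ^+ 2) * lip W W.
Proof.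
rewrite U02; move: (W) nW => w nw; rewrite !lipE (lipC w (lcross _ _)).
by rewrite lip_lcrossr lip_lcross_lcross nw nn; ring.
Qed.

(** Both vectors are isotropic, so the square of their difference is [-2 <U0, U2>]. *)
Let lip_U02 : lip U0 U2 = - ((al ^+ 2 + ga ^+ 2) * lip W W) / 2.
Proof.
have U0U0 : lip U0 U0 = 0.
  by case: F0 => NN TT TN _ _; rewrite lipZl lipZr lip_isotropic_dir ?mulr0.
have U2U2 : lip U2 U2 = 0.
  by case: F2 => NN TT TN _ _; rewrite lipZl lipZr lip_isotropic_dir ?mulr0.
rewrite -lip_UU; move: (U0) (U2) U0U0 U2U2 => u v uu vv.
by rewrite !lipE uu vv (lipC v u); field.
Qed.

Let norm_al_ga : al ^+ 2 + ga ^+ 2 = (a + d * c * L) ^+ 2.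
Proof. by have := sgradius_sqr nn F0; rewrite /al /ga => e; ring: e d2 s2. Qed.

(** By [norm_al_ga], a vanishing product would need [a = - d c L]. Together with [L^2 = a^2 - 1]
    this would give [(s L)^2 = -1]. *)
Lemma lip_dir_neq0 : N0 <> N2 -> lip (dir N0 T0) (dir N2 T2) != 0.
Proof.
move=> N02; apply/eqP => u0.
have /eqP : lip U0 U2 = 0 by rewrite lipZl lipZr u0 !mulr0.
rewrite lip_U02 mulf_eq0 oppr_eq0 mulf_eq0 invr_eq0 pnatr_eq0 orbF.
case/orP=> [|/eqP/(chord_eq0 F2 F0)//].
rewrite norm_al_ga sqrf_eq0 addr_eq0 => /eqP al0.
have e : a ^+ 2 = (d * c * L) ^+ 2 by rewrite {1}al0 sqrrN.
have : (s * L) ^+ 2 = -1.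
  have -> : (s * L) ^+ 2 = L ^+ 2 - (d * c * L) ^+ 2 by ring: d2 s2.
  by rewrite -e (sgradius_sqr nn F0); ring.
by move=> h; have := sqr_ge0 (s * L); rewrite h; lra.
Qed.

(** In the determinant U0 may be replaced by [U0 - U2]. Both D and [U0 - U2] are orthogonal to [n],
    so their cross product is a multiple of [n], and only [<n, U2>] is left to compute. *)
Lemma lip_lcross_chord_dir :
  lip (lcross ((a * s) *: lcross n W - c *: W) (dir N0 T0)) (dir N2 T2)
    = L ^+ 2 * (2 * s * lip (dir N0 T0) (dir N2 T2)).
Proof.
set D := _ - _.
suff : lip (lcross D U0) U2 = L ^+ 2 * (2 * s * lip U0 U2).
  rewrite /U0 /U2 lcrossZr !lipE => e.
  by apply: (mulfI l0); apply: (mulfI l0); rewrite e; ring.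
have -> : lip (lcross D U0) U2 = lip (lcross D (U0 - U2)) U2.
  move: (U0) (U2) => u v.
  by rewrite lcrossDr lcrossNr lipDl lipNl lip_lcrossr subr0.
have -> : lcross D (U0 - U2) = ((a * s * al - c * ga) * lip W W) *: n.
  rewrite U02 /D; move: (W) nW => w nw.
  rewrite !lcrossDE (lcrossC (lcross n w)) lcross_lcross (lipC w n) nw.
  by apply/rowP => j; rewrite !mxE; ring.
have nU2 : lip n U2 = d * c - a * al.
  rewrite /U2 -{1}el sgradius_dir// el !lipE nn (lipC n N2).
  case: F2 => _ _ _ -> _.
  by rewrite (lipC n (lcross _ _)) lip_lcrossl /al; ring.
rewrite lipZl nU2 lip_U02 norm_al_ga /al /ga.
have e := sgradius_sqr nn F0.
by field: e d2 s2.
Qed.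

End TwoFrames.

End Chords.

(** * Consecutive chords, and the closing condition on four of them *)

Section TangentialQuadrilateral.
Variables (R : realType) (n : 'rV[R]_3) (a c s : R).
Hypotheses (nn : lip n n = -1) (cs : c ^+ 2 + s ^+ 2 = 1).
Implicit Types N T : 'rV[R]_3.
Local Notation l := (sgradius n).
Local Notation rotT N T := (c *: T + s *: lcross T N).
Local Notation frame := (tangent_frame n a).

(** If N0 = N2 then T0 = T2, and adding the chord relations gives [(r1 + r2) (T0 + T1) = 0]. Hence
    N1 = N0, which [tangent_chord_neq] excludes. *)
Lemma two_chords_neq N0 T0 N1 T1 N2 T2 r1 r2 :
  frame N0 T0 -> frame N1 T1 -> frame N2 T2 -> 0 < r1 -> 0 < r2 ->
  N1 - N0 = r1 *: (T0 + T1) -> N2 - N1 = r2 *: (T1 + T2) ->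
  l N0 T0 != 0 -> l N1 T1 = l N0 T0 -> l N2 T2 = l N0 T0 -> N0 <> N2.
Proof.
move=> F0 F1 F2 r10 r20 e1 e2 l0 l1 l2 N02.
have T02 : T0 = T2.
  by apply: (scalerI l0); rewrite -{2}l2 (sgradius_T F0) (sgradius_T F2) N02.
apply: (tangent_chord_neq F0 F1 (lt0r_neq0 r10) e1 l0 l1).
suff S0 : T0 + T1 = 0 by apply/eqP; rewrite -subr_eq0 e1 S0 scaler0.
have : (r1 + r2) *: (T0 + T1) = 0.
  by rewrite scalerDl -e1 [T0 + T1]addrC T02 -e2 N02 addrC addrA subrK subrr.
by move/eqP; rewrite scaler_eq0 gt_eqF ?addr_gt0// => /eqP.
Qed.

(** After scaling by [l ^+ 2], the contributions of N1 and of [n] to [x02] cancel between the two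
    chords. What remains is the chord vector of [lip_lcross_chord_dir]. *)
Lemma lip_lcross_contact_points N0 T0 N1 T1 N2 T2 r1 r2 d :
  frame N0 T0 -> frame N1 T1 -> frame N2 T2 -> r1 != 0 -> r2 != 0 ->
  N1 - N0 = r1 *: (T0 + T1) -> N2 - N1 = r2 *: (T1 + T2) ->
  l N0 T0 != 0 -> l N1 T1 = l N0 T0 -> l N2 T2 = l N0 T0 -> d ^+ 2 = 1 ->
  let u0 := N0 + d *: (- s *: T0 + c *: lcross T0 N0) in
  let u2 := N2 + d *: (- s *: T2 + c *: lcross T2 N2) in
  let x02 := r2^-1 *: (rotT N1 T1 - rotT N2 T2)
             - r1^-1 *: (rotT N0 T0 - rotT N1 T1) in
  lip (lcross x02 u0) u2 = 2 * s * lip u0 u2.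
Proof.
move=> F0 F1 F2 r10 r20 e1 e2 l0 l1 l2 d2 u0 u2 x02.
have l20 : l N0 T0 ^+ 2 != 0 by rewrite sqrf_eq0.
apply: (mulfI l20); rewrite -(lip_lcross_chord_dir nn cs d2 F0 F2 l2 l0).
rewrite -lipZl -lcrossZl; congr (lip (lcross _ _) _).
rewrite /x02 scalerBr (tangent_chord_rotT c s nn F0 F1 r10 e1 l1) -{1}l1.
rewrite (tangent_chord_rotT c s nn F1 F2 r20 e2) ?l1//.
rewrite !lcrossDr lcrossNr.
move: (lcross n _) (lcross n _) (lcross n _) => x y z.
by apply/rowP => j; rewrite !mxE; ring.
Qed.

Lemma lip_rotT_normal N T : frame N T -> lip (rotT N T) n = - (s * l N T).
Proof. by case=> _ _ _ _ Tn; rewrite lipDl !lipZl Tn /sgradius; ring. Qed.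

(** Scaled by [l], the difference of the rotated tangents is [c (n x W) + a s W], whose square is
    [(1 + (s l)^2) <W, W>]. *)
Lemma rotT_inj N0 T0 N1 T1 : frame N0 T0 -> frame N1 T1 ->
  l N1 T1 = l N0 T0 -> rotT N0 T0 = rotT N1 T1 -> N1 = N0.
Proof.
move=> F0 F1 el e; apply: (chord_eq0 nn F0 F1); set W := N1 - N0.
have nW : lip n W = 0 := chord_normal F0 F1.
have : c *: lcross n W + (a * s) *: W = 0.
  have : l N0 T0 *: rotT N1 T1 - l N0 T0 *: rotT N0 T0 = 0 by rewrite e subrr.
  rewrite -{1}el !scalerDr ![_ *: (c *: _)]scalerA ![_ *: (s *: _)]scalerA.
  rewrite ![_ * c]mulrC ![_ * s]mulrC -!scalerA.
  rewrite (sgradius_T F0) (sgradius_T F1) (sgradius_B F0) (sgradius_B F1) => <-.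
  rewrite /W lcrossDr lcrossNr; move: (lcross n _) (lcross n _) => x y.
  by apply/rowP => j; rewrite !mxE; ring.
move: (W) nW => w nw e0.
have : lip (c *: lcross n w + (a * s) *: w)
  (c *: lcross n w + (a * s) *: w) = 0 by rewrite e0 /lip !mxE; ring.
rewrite !lipE (lipC w (lcross _ _)) lip_lcrossr lip_lcross_lcross nw nn.
have -> : c * (c * (0 ^+ 2 - -1 * lip w w) + a * s * 0)
    + a * s * (c * 0 + a * s * lip w w)
  = (1 + (s * l N0 T0) ^+ 2) * lip w w.
  have h := sgradius_sqr nn F0.
  have c2 : c ^+ 2 = 1 - s ^+ 2 by rewrite -cs addrK.
  by rewrite exprMn h; ring: c2.
move/eqP; rewrite mulf_eq0 gt_eqF ?orFb ?ltr_pwDl ?sqr_ge0 ?ltr01//.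
by move/eqP.
Qed.

(* Without the closing condition the contact points may coincide in pairs, the
   quadrilateral being folded onto a single edge. *)
Lemma closed_no_flip N0 T0 N1 T1 N2 T2 N3 T3 r0 r1 r2 r3 :
  frame N0 T0 -> frame N1 T1 -> frame N2 T2 -> frame N3 T3 ->
  0 < r0 -> 0 < r1 -> 0 < r2 -> 0 < r3 ->
  N1 - N0 = r1 *: (T0 + T1) -> N2 - N1 = r2 *: (T1 + T2) ->
  N3 - N2 = r3 *: (T2 + T3) ->
  (r0^-1 + r1^-1) *: rotT N0 T0 - (r1^-1 + r2^-1) *: rotT N1 T1
  + (r2^-1 + r3^-1) *: rotT N2 T2 - (r3^-1 + r0^-1) *: rotT N3 T3 = 0 ->
  s != 0 -> l N0 T0 != 0 -> l N1 T1 = l N0 T0.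
Proof.
move=> F0 F1 F2 F3 r00 r10 r20 r30 e1 e2 e3 clo s0 l0.
have pm N T : frame N T -> l N T = l N0 T0 \/ l N T = - l N0 T0.
  move=> F; have /eqP : l N T ^+ 2 = l N0 T0 ^+ 2.
    by rewrite (sgradius_sqr nn F) (sgradius_sqr nn F0).
  by rewrite eqf_sqr => /orP[] /eqP; [left | right].
have [L1 L2 L3] := And3 (pm _ _ F1) (pm _ _ F2) (pm _ _ F3).
case: L1 => // l1; exfalso.
(* Pairing the closing condition with [n] leaves only the B components, with the common factor
   [- s]. *)
have cln : (r0^-1 + r1^-1) * l N0 T0 - (r1^-1 + r2^-1) * l N1 T1
  + (r2^-1 + r3^-1) * l N2 T2 - (r3^-1 + r0^-1) * l N3 T3 = 0.
  apply: (mulfI s0); rewrite mulr0.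
  have : lip (- ((r0^-1 + r1^-1) *: rotT N0 T0 - (r1^-1 + r2^-1) *: rotT N1 T1
    + (r2^-1 + r3^-1) *: rotT N2 T2 - (r3^-1 + r0^-1) *: rotT N3 T3)) n = 0.
    by rewrite clo /lip !mxE; ring.
  move: (lip_rotT_normal F0) (lip_rotT_normal F1).
  move: (lip_rotT_normal F2) (lip_rotT_normal F3).
  move: (rotT N0 T0) (rotT N1 T1) (rotT N2 T2) (rotT N3 T3).
  move=> x0 x1 x2 x3 h3 h2 h1 h0.
  by rewrite !lipE h0 h1 h2 h3 => <-; ring.
have [p0 p1 p2 p3] : [/\ 0 < r0^-1, 0 < r1^-1, 0 < r2^-1 & 0 < r3^-1].
  by rewrite !invr_gt0.
(* With [l1 = - l0], the three other sign patterns turn [cln] into a positive multiple of [l0]. In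
   the surviving one, the first and third chords both flip. *)
have [l2 l3] : l N2 T2 = - l N0 T0 /\ l N3 T3 = l N0 T0.
  have no q : 0 < q -> q * l N0 T0 = 0 -> False.
    by move=> q0 /eqP; rewrite mulf_eq0 (negPf l0) gt_eqF.
  move: cln; rewrite l1; case: L2 => ->; case: L3 => -> // e; exfalso.
  - by apply: (no (2 * (r1^-1 + r2^-1))); [lra | rewrite -[RHS]e; ring].
  - by apply: (no (2 * (r0^-1 + r1^-1 + r2^-1 + r3^-1)));
      [lra | rewrite -[RHS]e; ring].
  - by apply: (no (2 * (r0^-1 + r1^-1))); [lra | rewrite -[RHS]e; ring].
have [N10 T10] := tangent_chord_flip nn F0 F1 (lt0r_neq0 r10) e1 l0 l1.
have [N32 T32] : N3 = N2 /\ T3 = - T2.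
  apply: (tangent_chord_flip nn F2 F3 (lt0r_neq0 r30) e3).
    by rewrite l2 oppr_eq0.
  by rewrite l2 opprK.
(* After both flips the closing condition reads [q (rotT N0 T0 + rotT N2 T2) = 0] with [q > 0]. It
   forces N1 = N2, although the second chord does not flip. *)
have e : rotT N1 T1 = rotT N2 T2.
  have q0 : 0 < r0^-1 + 2 * r1^-1 + r2^-1 by lra.
  have qE : r2^-1 + 2 * r3^-1 + r0^-1 = r0^-1 + 2 * r1^-1 + r2^-1.
    apply: (mulIf l0); apply/eqP; rewrite -subr_eq0 -oppr_eq0; apply/eqP.
    by rewrite -[RHS]cln l1 l2 l3; ring.
  move: clo; rewrite N10 T10 N32 T32 !lcrossNl.
  move: (lcross T0 N0) (lcross T2 N2) => x y.
  have -> : (r0^-1 + r1^-1) *: (c *: T0 + s *: x)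
      - (r1^-1 + r2^-1) *: (c *: (- T0) + s *: (- x))
      + (r2^-1 + r3^-1) *: (c *: T2 + s *: y)
      - (r3^-1 + r0^-1) *: (c *: (- T2) + s *: (- y))
    = (r0^-1 + 2 * r1^-1 + r2^-1) *: (c *: T0 + s *: x)
      + (r2^-1 + 2 * r3^-1 + r0^-1) *: (c *: T2 + s *: y).
    by apply/rowP => j; rewrite !mxE; ring.
  rewrite qE -scalerDr => /eqP; rewrite scaler_eq0 gt_eqF//= addrC addr_eq0.
  by move=> /eqP ->; rewrite opprD -!scalerN.
have l12 : l N2 T2 = l N1 T1 by rewrite l1.
have l10 : l N1 T1 != 0 by rewrite l1 oppr_eq0.
by have := tangent_chord_neq F1 F2 (lt0r_neq0 r20) e2 l10 l12; apply;
  exact: (rotT_inj F1 F2).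
Qed.

End TangentialQuadrilateral.

(** * Combinatorics of black and white vertices *)

Section Lattice.

Lemma ord4P (P : 'I_4 -> Prop) : P 0 -> P 1 -> P 2 -> P 3 -> forall k, P k.
Proof.
move=> p0 p1 p2 p3 [[|[|[|[|//]]]] k4].
- by rewrite (_ : Ordinal k4 = 0) //; apply/val_inj.
- by rewrite (_ : Ordinal k4 = 1) //; apply/val_inj.
- by rewrite (_ : Ordinal k4 = 2) //; apply/val_inj.
- by rewrite (_ : Ordinal k4 = 3) //; apply/val_inj.
Qed.

Lemma white_bwhite b k : black b -> white (bwhite b k).
Proof.
rewrite /white /black /bwhite; case: b => b1 b2 /=.
by move: k; apply: ord4P => /=; lia.
Qed.

Lemma incident_black b k : incident b (bface b k).
Proof.
rewrite /incident /bface opprD addrA subrr sub0r.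
by move: k; apply: ord4P.
Qed.

Lemma incident_bwhite b k : incident (bwhite b k) (bface b k).
Proof.
rewrite /incident /bface /bwhite opprD addrACA subrr add0r.
by move: k; apply: ord4P.
Qed.

Lemma incident_bwhiteS b k : incident (bwhite b (k + 1)) (bface b k).
Proof.
rewrite /incident /bface /bwhite opprD addrACA subrr add0r.
by move: k; apply: ord4P.
Qed.

Lemma white_edge_bwhite b k :
  black b -> white_edge (bface b k) (bwhite b k) (bwhite b (k + 1)).
Proof.
move=> bb; rewrite /white_edge !white_bwhite// incident_bwhite incident_bwhiteS.
rewrite /= /bwhite (inj_eq (addrI b)).
by move: k; apply: ord4P.
Qed.

(** The exponent is [k.+1] because the edge at [k = 0], from (1, 0) to (0, 1), is vertical; the two
    kinds then alternate. *)
Lemma edge_sign_bwhite (R : realType) b k :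
  edge_sign R (bwhite b k) (bwhite b (k + 1)) = (-1) ^+ k.+1.
Proof.
have E (x y : vertex) : (b + x) - (b + y) = x - y.
  by rewrite opprD addrACA subrr add0r.
rewrite /edge_sign /horizontal /bwhite !E.
by move: k; apply: ord4P => /=; rewrite !exprS expr0; ring.
Qed.

(** The black vertices are the points [(p - q, p + q)], and the two hypotheses are unit steps in p
    and q; induction runs over p on the line [q = 0], then over q. *)
Lemma const_on_black (A : Type) (r : vertex -> A) :
  (forall b, black b -> r (b + (1, 1)) = r b) ->
  (forall b, black b -> r (b + (-1, 1)) = r b) ->
  forall b, black b -> r b = r 0.
Proof.
move=> h1 h2 [b1 b2] bb.
have bl (p q : int) : black (p - q, p + q) by rewrite /black /=; lia.
have st1 (p q : int) : r (p + 1 - q, p + 1 + q) = r (p - q, p + q).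
  rewrite -(h1 (p - q, p + q) (bl p q)); congr r.
  by apply/eqP; rewrite xpair_eqE /=; lia.
have st2 (p q : int) : r (p - (q + 1), p + (q + 1)) = r (p - q, p + q).
  rewrite -(h2 (p - q, p + q) (bl p q)); congr r.
  by apply/eqP; rewrite xpair_eqE /=; lia.
suff main (p q : int) : r (p - q, p + q) = r 0.
  move: bb; rewrite /black /= => /dvdzP[p ep].
  rewrite -(main p (b2 - p)); congr (r (_, _)); lia.
have col (p' : int) : r (p' - 0, p' + 0) = r 0.
  elim/int_rect: p' => [//|n <-|n <-].
    rewrite -(st1 n 0); congr r; apply/eqP; rewrite xpair_eqE; lia.
  rewrite -(st1 (- n.+1%:Z) 0); congr r; apply/eqP; rewrite xpair_eqE; lia.
elim/int_rect: q => [|n <-|n <-]; first exact: col.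
  rewrite -(st2 p n); congr r; apply/eqP; rewrite xpair_eqE; lia.
rewrite -(st2 p (- n.+1%:Z)); congr r; apply/eqP; rewrite xpair_eqE; lia.
Qed.

End Lattice.

(** * Oriented contact of spheres and isotropic lines *)

Section Lines.
Variable R : realType.
Implicit Types (v x u : 'rV[R]_3) (S : osphere R) (l : oline R).

Lemma isotropic_neq0 v : v <> 0 -> lip v v = 0 -> v 0 2 != 0.
Proof.
move=> v0 vv; apply/eqP => c0; apply: v0.
move: vv; rewrite /lip c0 mulr0 subr0 -!expr2 => /eqP.
rewrite paddr_eq0 ?sqr_ge0// !sqrf_eq0 => /andP[/eqP a0 /eqP b0].
by apply: vec3P; rewrite mxE.
Qed.

(** On the light cone the Euclidean length of [v'] is the absolute value of [v_3], and
    [(J v', 0) x v = v_3 v]. *)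
Lemma lcross_nu v : v <> 0 -> lip v v = 0 ->
  lcross (nu v) v = Num.sg (v 0 2) *: v.
Proof.
move=> v0 vv; have c0 := isotropic_neq0 v0 vv.
have ab : v 0 0 ^+ 2 + v 0 1 ^+ 2 = v 0 2 ^+ 2.
  by apply/eqP; rewrite -subr_eq0; apply/eqP; rewrite -[RHS]vv /lip !expr2.
rewrite /nu ab sqrtr_sqr lcrossZl.
have -> : lcross (mkvec (- v 0 1) (v 0 0) 0) v = v 0 2 *: v.
  apply: vec3P; rewrite !mxE /=; [by ring | by ring |].
  by rewrite -!expr2 -ab; ring.
have c1 : `|v 0 2| != 0 by rewrite normr_eq0.
rewrite scalerA; congr (_ *: _).
by rewrite -{2}[v 0 2]mulr_sg_norm mulrC mulfK.
Qed.

(** The cross product with [u] kills displacements along the line, and both sides are linear in [u].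
    So any point and direction may describe the line; its orientation survives only in the sign. *)
Lemma line_contact_lcross S l x u : line_contact S l ->
  oline_points l = line_points x u ->
  lcross (x - centre S) u = (radius S * Num.sg (ldir l 0 2)) *: u.
Proof.
case=> t e lx.
have [t0 _ e0] : oline_points l x.
  by rewrite lx; exists 0; rewrite ?scale0r ?addr0.
have [t1 _ e1] : oline_points l (x + u).
  by rewrite lx; exists 1; rewrite ?scale1r.
have -> : u = (t1 - t0) *: ldir l.
  by rewrite -[LHS](addKr x) -e1 -e0; apply/rowP => j; rewrite !mxE; ring.
rewrite -e0 addrAC e -addrA -scalerDl lcrossZr lcrossDl.
rewrite (lcrossZl _ (nu _)) (lcrossZl _ (ldir l)) lcrossxx scaler0 addr0.
rewrite (lcross_nu (@ldir_neq0 _ l) (ldir_isotropic l)) !scalerA.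
by congr (_ *: _); ring.
Qed.

End Lines.

(** * Radii and frames of a Koebe net *)

Section KoebeNets.
Variable R : realType.
Implicit Types (h : snet R) (C : spcircle R) (S : osphere R).

(** Here [o] is the foot of the perpendicular from the centre of the sphere to the plane. About [o]
    the circle is visibly symmetric, which yields further points from a given one. *)
Lemma circle_foot C : exists o k, forall x,
  circle_points C x <->
    lip (cnormal C) (x - o) = 0 /\ lip (x - o) (x - o) = k.
Proof.
case: C => Q p n n0 nd /=; set q := centre Q.
pose t := lip n (q - p) / lip n n.
have nt : lip n n != 0 by rewrite lt_eqF.
exists (q - t *: n), (radius Q ^+ 2 - t ^+ 2 * lip n n) => x.
have E : lip n (x - (q - t *: n)) = lip (x - p) n.
  by rewrite !lipE /t !lipE (lipC x n) (lipC p n); field.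
rewrite /circle_points /sphere_points /plane_points /= -/q.
have E2 : lip (x - q) (x - q) = lip (x - (q - t *: n)) (x - (q - t *: n))
    - 2 * t * lip n (x - (q - t *: n)) + t ^+ 2 * lip n n.
  by rewrite !lipE (lipC x q) (lipC x n) (lipC q n); ring.
split=> [[h1 h2]|[h1 h2]].
  by rewrite E; split=> //; rewrite -h1 E2 E h2; ring.
by rewrite /= -E; split=> //; rewrite E2 h1 h2; ring.
Qed.

(* The normal of the plane of C is proportional to the centre m of S, because
   <x, m> = -1 on C; hence m is timelike, and <m, m> = radius S ^+ 2 - 1. *)
Lemma orthogonal_sphere_radius S C :
  meets_Uplus_orthogonally_in S C -> radius S ^+ 2 < 1.
Proof.
case=> CS orth; set m := centre S.
have cm z : circle_points C z -> lip z m = -1.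
  move=> Cz; have := orth _ Cz; move: Cz; rewrite CS => -[_ [zz _]].
  by rewrite lipDl lipNl zz (lipC _ z) -/m => e; lra.
have [o [k Ck]] := circle_foot C.
have [x [y [xy Cx Cy]]] := cnondegenerate C.
rewrite -!/(circle_points C) in Cx Cy.
have n0 := cnormal_timelike C; move: (cnormal C) n0 Ck => n n0 Ck.
have [nu uk] := (Ck x).1 Cx; set u := x - o in nu uk.
(* Otherwise every point of the circle would coincide with [o]. *)
have uu0 : lip u u != 0.
  apply/eqP => uu; apply: xy.
  have [ny yk] := (Ck y).1 Cy.
  have x0 := orthogonal_timelike_eq0 n0 nu uu.
  have y0 : y - o = 0 by apply: (orthogonal_timelike_eq0 n0 ny); rewrite yk -uk.
  by rewrite -[x](subrK o) -/u x0 -y0 subrK.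
(* The antipode of x and, below, its quarter turn lie on the circle too. The value [<z, m> = -1] at
   these three points makes m orthogonal to [u] and to [lcross n u], hence parallel to [n]. *)
have Cn : circle_points C (o - u).
  apply/Ck; rewrite addrAC subrr add0r lipNr nu oppr0; split=> //.
  by rewrite lipNl lipNr opprK.
set r := Num.sqrt (- lip n n).
have sq : r ^+ 2 = - lip n n.
  by rewrite sqr_sqrtr // oppr_ge0 ltW.
have s0 : r != 0.
  by rewrite -sqrf_eq0 sq oppr_eq0 lt_eqF.
have Cc : circle_points C (o + r^-1 *: lcross n u).
  apply/Ck; rewrite addrAC subrr add0r lipZr lipC lip_lcrossl mulr0; split=> //.
  rewrite lipZl lipZr lip_lcross_lcross nu -uk.
  by rewrite -[lip n n]opprK -sq; field.
have h1 : lip o m + lip u m = -1 by rewrite -lipDl addrC subrK; apply: cm.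
have h2 : lip o m - lip u m = -1 by rewrite -lipNl -lipDl; apply: cm.
have um : lip u m = 0 by lra.
have om : lip o m = -1 by lra.
have nm : lip (lcross n u) m = 0.
  have := cm _ Cc; rewrite lipDl om lipZl => e.
  have /eqP : r^-1 * lip (lcross n u) m = 0 by lra.
  by rewrite mulf_eq0 invr_eq0 (negPf s0) => /eqP.
have mn : lip n n *: m = lip m n *: n.
  have E1 : lcross u (lcross n u) = - lip u u *: n.
    by rewrite lcross_lcross (lipC u n) nu scale0r sub0r scaleNr.
  have E2 : lcross (lcross n u) n = - lip n n *: u.
    by rewrite lcrossC lcross_lcross nu scale0r subr0 scaleNr.
  have := lcross_cramer n u (lcross n u) m.
  rewrite E1 E2 !lipZr (lipC m u) um (lipC m (lcross n u)) nm lip_lcross_lcross.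
  rewrite nu mulr0 !scale0r !addr0 expr0n sub0r => e.
  apply: (scalerI uu0); rewrite !scalerA mulrC; apply: oppr_inj.
  by rewrite -scaleNr e -scaleNr mulNr.
have m0 : m <> 0.
  move=> m0; move: om; rewrite m0 /lip !mxE => /eqP.
  by rewrite !mulr0 addr0 subrr eq_sym oppr_eq0 oner_eq0.
have mm : lip m m < 0.
  have : lip n n ^+ 2 * lip m m = lip m n ^+ 2 * lip n n.
    by rewrite expr2 -mulrA -lipZr -lipZl mn lipZl lipZr mulrA.
  have mn0 : lip m n != 0.
    apply/eqP => mn0; apply: m0; apply/eqP.
    by move/eqP: mn; rewrite mn0 scale0r scaler_eq0 lt_eqF.
  have n4 : 0 < lip n n ^+ 2 by rewrite lt0r sqrf_eq0 lt_eqF// sqr_ge0.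
  have mn2 : 0 < lip m n ^+ 2 by rewrite lt0r sqrf_eq0 mn0 sqr_ge0.
  by move=> e; rewrite -(pmulr_rlt0 _ n4) e pmulr_rlt0.
have := orth _ Cx; move: Cx; rewrite CS => -[+ [xx _]].
rewrite /sphere_points /= -/m !lipE xx (lipC m x) => e1 e2.
lra.
Qed.

Lemma hradius_gt0 h w : S_isothermic h -> white w -> 0 < hradius h w.
Proof. by case=> hw _ _ /hw; rewrite normr_gt0 => /eqP. Qed.

Lemma hradius_lt1 h w : Koebe h -> white w -> hradius h w < 1.
Proof.
case=> _ _ + _ ww => /(_ w ww)[C /orthogonal_sphere_radius].
by rewrite -[_ ^+ 2]real_normK ?num_real// expr_lt1.
Qed.

(** The radii of the two spheres fix the length of the segment of centres and the position of N on
    it. T is orthogonal to N because the white sphere meets Uplus orthogonally there. *)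
Lemma koebe_frame h f w w' b : Koebe h -> white_edge f w w' -> black b ->
  incident b f ->
  [/\ lip (hpoint h f) (hpoint h f) = -1,
      lip (frameT h w w') (frameT h w w') = 1,
      lip (frameT h w w') (hpoint h f) = 0,
      hpoint h f - centre (hsphere h w) = hradius h w *: frameT h w w' &
      hpoint h f - centre (hsphere h w') = - hradius h w' *: frameT h w w'].
Proof.
move=> K we bb bf; have [Si hU hO hE] := K.
have /and5P[ww ww' wf w'f _] := we.
have r0 := hradius_gt0 Si ww; have r0' := hradius_gt0 Si ww'.
have [t [/andP[t0 t1]]] := hE _ _ _ we.
have [_ _ hC] := Si; have [CN SN _] := hC f w b ww bb wf bf.
have [_ SN' _] := hC f w' b ww' bb w'f bf.
have UN := hU b bb _ CN; have [NN _] := UN.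
have [C [CS orth]] := hO w ww.
have : lip (hpoint h f - centre (hsphere h w)) (hpoint h f) = 0.
  by apply: orth; rewrite CS.
move: SN SN'; rewrite /sphere_points /frameT /=.
rewrite -!(real_normK (num_real (radius _))) -!/(hradius h _).
move: (hradius h w) (hradius h w') r0 r0' => r r' r0 r0'.
move: (centre (hsphere h w)) (centre (hsphere h w')) (hpoint h f) NN.
move=> m m' N NN e1 e2 mN Ne.
have Nm : N - m = t *: (m' - m).
  by rewrite Ne; apply/rowP => j; rewrite !mxE; ring.
have Nm' : N - m' = - (1 - t) *: (m' - m).
  by rewrite Ne; apply/rowP => j; rewrite !mxE; ring.
have t00 : t != 0 by rewrite gt_eqF.
have ee : lip (m' - m) (m' - m) = (r / t) ^+ 2.
  apply: (mulfI (_ : t ^+ 2 != 0)); first by rewrite sqrf_eq0.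
  by rewrite expr2 -mulrA -lipZr -lipZl -Nm e1; field.
have L : lnorm (m' - m) = r / t.
  by rewrite /lnorm ee sqrtr_sqr ger0_norm// divr_ge0// ltW.
have rE : r' = (1 - t) * (r / t).
  apply/eqP; rewrite -(eqrXn2 (isT : (0 < 2)%N)) ?(ltW r0')//; last first.
    by rewrite mulr_ge0 ?subr_ge0 ?divr_ge0// ltW.
  by rewrite -e2 Nm' lipZl lipZr ee; apply/eqP; ring.
have r00 : r != 0 by rewrite gt_eqF.
rewrite L; split=> //.
- by rewrite lipZl lipZr ee; field; rewrite r00 t00.
- apply: (mulfI r00); rewrite mulr0 -[RHS]mN Nm !lipZl; field.
  by rewrite r00 t00.
- by rewrite Nm scalerA; congr (_ *: _); field; rewrite r00 t00.
- by rewrite Nm' rE scalerA; congr (_ *: _); field; rewrite r00 t00.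
Qed.

End KoebeNets.

(** * The signed radius of the sphere at one black vertex *)

Section AssociatedCongruences.
Variable R : realType.

(** Parallel normals give [k p = p'] or [k p = - p']. The first would make the distance of the
    centres [|p - p'|] instead of [p + p'], so the spheres touch from outside. *)
Lemma touch_at_centres (S S' : osphere R) x e p p' t : touch_at S S' x ->
  centre S' - centre S = (e * (p + p')) *: t -> lip t t = 1 -> e ^+ 2 = 1 ->
  `|radius S| = p -> `|radius S'| = p' -> 0 < p -> 0 < p' ->
  x - centre S = (e * p) *: t /\ x - centre S' = - (e * p') *: t.
Proof.
case=> h1 h2 [k ek] em tt e2 rp rp' p0 p0'.
move: h1 h2; rewrite /sphere_points /=.
rewrite -!(real_normK (num_real (radius _))) rp rp'.
move: (centre S) (centre S') ek em => m m' ek em h1 h2.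
have mk : m' - m = (1 - k) *: (x - m).
  by rewrite scalerBl -ek scale1r opprB [RHS]addrC addrA subrK.
have kp : k * p = - p'.
  have : (k * p) ^+ 2 = p' ^+ 2 by rewrite -h2 ek lipZl lipZr h1; ring.
  move/eqP; rewrite eqf_sqr => /orP[/eqP kp|/eqP//]; exfalso.
  have : ((1 - k) * p) ^+ 2 = (p + p') ^+ 2.
    have -> : ((1 - k) * p) ^+ 2 = lip (m' - m) (m' - m).
      by rewrite mk lipZl lipZr h1; ring.
    by rewrite em lipZl lipZr tt; ring: e2.
  rewrite mulrBl mul1r kp => e3; have : p * p' = 0 by nra.
  by move/eqP; rewrite mulf_eq0 !gt_eqF.
have pp : p + p' != 0 by rewrite gt_eqF ?addr_gt0.
have xm : x - m = (e * p) *: t.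
  have E : p *: ((1 - k) *: (x - m)) = (p + p') *: (x - m).
    by rewrite scalerA mulrBr mulr1 mulrC kp opprK.
  by apply: (scalerI pp); rewrite -E -mk em !scalerA; congr (_ *: _); ring.
split=> //; rewrite ek xm scalerA; congr (_ *: _).
by rewrite mulrCA kp; ring.
Qed.

Lemma scaler_inj_l (v : 'rV[R]_3) (x y : R) :
  v != 0 -> x *: v = y *: v -> x = y.
Proof.
move=> v0 /eqP; rewrite -subr_eq0 -scalerBl scaler_eq0 (negPf v0) orbF.
by rewrite subr_eq0 => /eqP.
Qed.

Lemma sqr_edge_sign w w' : edge_sign R w w' ^+ 2 = 1.
Proof. by rewrite /edge_sign; case: ifP; rewrite ?expr1n ?sqrrN ?expr1n. Qed.

Lemma edge_signS b k :
  edge_sign R (bwhite b (k + 1)) (bwhite b (k + 1 + 1))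
    = - edge_sign R (bwhite b k) (bwhite b (k + 1)).
Proof.
rewrite !edge_sign_bwhite; move: k.
by apply: ord4P => /=; rewrite !exprS expr0; ring.
Qed.

(** The index wraps around modulo 4, which is even, so parity still alternates. *)
Lemma sign_ordS (s : bool) (k : 'I_4) :
  (-1) ^+ (s + (k + 1)%R)%N = - (-1) ^+ (s + k)%N :> R.
Proof.
rewrite !exprD -mulrN; congr (_ * _).
by move: k; apply: ord4P => /=; rewrite !exprS expr0; ring.
Qed.

Lemma ordS4 (k : 'I_4) : k + 1 + 1 + 1 + 1 = k.
Proof. by move: k; apply: ord4P; apply/val_inj. Qed.

Variables (h : snet R) (phi : R) (hphi : vertex -> osphere R).
Variable c : congruence R.
Hypotheses (K : Koebe h) (A : associated_member h phi hphi).
Hypothesis G : associated_congruence h phi hphi c.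
Variable b : vertex.
Hypothesis bb : black b.

Let N k := hpoint h (bface b k).
Let T k := frameT h (bwhite b k) (bwhite b (k + 1)).
Let r k := hradius h (bwhite b k).
Let sg k := edge_sign R (bwhite b k) (bwhite b (k + 1)).
Let M k := centre (hphi (bwhite b k)).
Let Tp k := cos phi *: T k + sin phi *: lcross (T k) (N k).
Let g k := Num.sg (ldir (cline c (bface b k)) 0 2).
Let u (s : bool) (k : 'I_4) :=
  N k + (-1) ^+ (s + k)%N *: (- sin phi *: T k + cos phi *: lcross (T k) (N k)).

Let r_gt0 k : 0 < r k.
Proof. by case: K => Si _ _ _; apply: hradius_gt0 Si (white_bwhite k bb). Qed.

Let frameP k : [/\ lip (N k) (N k) = -1, lip (T k) (T k) = 1,
  lip (T k) (N k) = 0,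
  N k - centre (hsphere h (bwhite b k)) = r k *: T k &
  N k - centre (hsphere h (bwhite b (k + 1))) = - r (k + 1) *: T k].
Proof.
exact: (koebe_frame K (white_edge_bwhite k bb) bb (incident_black b k)).
Qed.

(** Both points are reached from the centre of the white sphere between them along the frame
    tangents, at distance [r (k + 1)]. *)
Let chord k : N (k + 1) - N k = r (k + 1) *: (T k + T (k + 1)).
Proof.
have [_ _ _ _ e0] := frameP k; have [_ _ _ e1 _] := frameP (k + 1).
rewrite -[N (k + 1)](subrK (centre (hsphere h (bwhite b (k + 1))))) e1.
rewrite -[N k](subrK (centre (hsphere h (bwhite b (k + 1))))) e0.
by apply/rowP => j; rewrite !mxE; ring.
Qed.

Let cs2 : cos phi ^+ 2 + sin phi ^+ 2 = 1. Proof. exact: cos2Dsin2. Qed.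

Let Tp1 k : lip (Tp k) (Tp k) = 1.
Proof. by have [NN TT TN _ _] := frameP k; apply: lip_rotT. Qed.

Let sgS k : sg (k + 1) = - sg k. Proof. exact: edge_signS. Qed.

Let M_step k : M (k + 1) - M k = (sg k * ((r k)^-1 + (r (k + 1))^-1)) *: Tp k.
Proof. by case: A => + _ _ => /(_ _ _ _ (white_edge_bwhite k bb)). Qed.

(** The increments of the white centres sum to zero around b, and their edge signs alternate. *)
Let closing k :
  ((r k)^-1 + (r (k + 1))^-1) *: Tp k
  - ((r (k + 1))^-1 + (r (k + 1 + 1))^-1) *: Tp (k + 1)
  + ((r (k + 1 + 1))^-1 + (r (k + 1 + 1 + 1))^-1) *: Tp (k + 1 + 1)
  - ((r (k + 1 + 1 + 1))^-1 + (r k)^-1) *: Tp (k + 1 + 1 + 1) = 0.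
Proof.
have s0 : sg k != 0.
  by rewrite -sqrf_eq0 sqr_edge_sign oner_eq0.
apply: (scalerI s0); rewrite scaler0.
have := M_step (k + 1 + 1 + 1); rewrite ordS4 !sgS.
have := M_step (k + 1 + 1); rewrite !sgS.
have := M_step (k + 1); rewrite !sgS.
have := M_step k.
move: (Tp _) (Tp _) (Tp _) (Tp _) => t3 t2 t1 t0 e0 e1 e2 e3.
transitivity ((M (k + 1) - M k) + (M (k + 1 + 1) - M (k + 1)) +
  (M (k + 1 + 1 + 1) - M (k + 1 + 1)) + (M k - M (k + 1 + 1 + 1))).
  rewrite e0 e1 e2 e3; apply/rowP => j; rewrite !mxE; ring.
by apply/rowP => j; rewrite !mxE; ring.
Qed.

Let tangent_frames : exists n a, [/\ lip n n = -1, a ^+ 2 != 1 &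
  forall k, tangent_frame n a (N k) (T k)].
Proof.
have [Si hU _ _] := K; have [_ _ hC] := Si.
have C0 k := hC _ _ _ (white_bwhite k bb) bb
  (incident_bwhite b k) (incident_black b k).
have n0 := cnormal_timelike (hcircle h b).
pose q := Num.sqrt (- lip (cnormal (hcircle h b)) (cnormal (hcircle h b))).
have q2 : q ^+ 2 = - lip (cnormal (hcircle h b)) (cnormal (hcircle h b)).
  by rewrite sqr_sqrtr // oppr_ge0 ltW.
have q0 : q != 0 by rewrite -sqrf_eq0 q2 oppr_eq0 lt_eqF.
pose n := q^-1 *: cnormal (hcircle h b).
have nn : lip n n = -1.
  by rewrite lipZl lipZr -[lip _ _]opprK -q2; field.
pose a := - lip (cpoint (hcircle h b)) n.
have Ca x : circle_points (hcircle h b) x -> lip x n = - a.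
  case=> _; rewrite /plane_points /= => e.
  have : lip (x - cpoint (hcircle h b)) n = 0 by rewrite lipZr e mulr0.
  by rewrite lipDl lipNl /a => ?; lra.
exists n, a; split=> // [|k]; last first.
  have [NN TT TN e _] := frameP k; have [CN _ [t1 _]] := C0 k.
  split=> //; first exact: Ca.
  have := t1; rewrite e lipZl => /eqP; rewrite mulf_eq0 gt_eqF//= => /eqP tn.
  by rewrite lipZr tn mulr0.
(* If [a^2 = 1], then [z - a n] is isotropic and orthogonal to [n] for each z on the circle, which
   would shrink to one point. *)
apply/eqP => a1; clearbody a; clearbody n.
have [x [y [xy Cx Cy]]] := cnondegenerate (hcircle h b).
have E z : circle_points (hcircle h b) z -> z = a *: n.
  move=> Cz; have [zz _] := hU _ bb _ Cz; have zn := Ca _ Cz.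
  apply/eqP; rewrite -subr_eq0; apply/eqP.
  apply: (orthogonal_timelike_eq0 (n := n)).
  - by rewrite nn oppr_lt0 ltr01.
  - by rewrite !lipE nn (lipC n) zn; ring.
  - by rewrite !lipE nn (lipC n) zn zz; ring: a1.
by apply: xy; rewrite (E x Cx) (E y Cy).
Qed.

Let faceP : exists s : bool, forall k, exists x : 'rV[R]_3,
  [/\ x - M k = (sg k * (r k)^-1) *: Tp k,
      x - M (k + 1) = - (sg k * (r (k + 1))^-1) *: Tp k &
      oline_points (cline c (bface b k)) = line_points x (u s k)].
Proof.
have [_ _ _ /(_ b bb)[s hs]] := G; exists s => k.
have [x [tx lx]] := hs k; exists x.
have [_ hr _] := A.
have [] := touch_at_centres tx (M_step k) (Tp1 k) (sqr_edge_sign _ _)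
   (hr _ (white_bwhite k bb)) (hr _ (white_bwhite (k + 1) bb)).
- by rewrite invr_gt0; apply: r_gt0.
- by rewrite invr_gt0; apply: r_gt0.
by move=> e1 e2; split.
Qed.

Let d2 s (k : 'I_4) : ((-1) ^+ (s + k)%N) ^+ 2 = 1 :> R.
Proof. by rewrite -exprM mulnC exprM sqrrN expr1n expr1n. Qed.

Let u_neq0 s k : u s k != 0.
Proof. by have [NN _ TN _ _] := frameP k; apply: isotropic_dir_neq0. Qed.

Let Tp_u s k : lcross (Tp k) (u s k) = (-1) ^+ (s + k)%N *: u s k.
Proof.
have [NN TT TN _ _] := frameP k.
exact: (lcross_rotT_dir NN TT TN cs2 (d2 s k)).
Qed.

Let contactP x s k v : incident v (bface b k) ->
  oline_points (cline c (bface b k)) = line_points x (u s k) ->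
  lcross (x - centre (csph c v)) (u s k) = (radius (csph c v) * g k) *: u s k.
Proof.
by move=> vk; apply: line_contact_lcross; case: G => + _ _ _; apply.
Qed.

(** The lines at both faces are in contact with the white sphere between them. The edge sign, the
    choice of N +- B and the side of the contact point all change, and an odd number of sign changes
    remains. *)
Lemma line_signS k : g (k + 1) = - g k.
Proof.
have [s hs] := faceP.
have [x0 [_ x0M l0]] := hs k; have [x1 [x1M _ l1]] := hs (k + 1).
have [_ hw _ _] := G; have ww := white_bwhite (k + 1) bb.
have := contactP (incident_bwhiteS b k) l0.
rewrite (hw _ ww) x0M lcrossZl Tp_u scalerA => /(scaler_inj_l (u_neq0 s k)) e0.
have := contactP (incident_bwhite b (k + 1)) l1.
rewrite (hw _ ww) x1M lcrossZl Tp_u scalerA => /(scaler_inj_l (u_neq0 s _)) e1.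
have r0 : radius (hphi (bwhite b (k + 1))) != 0.
  have [_ hr _] := A; rewrite -normr_eq0 hr//.
  by rewrite invr_eq0 gt_eqF//; apply: r_gt0.
apply: (mulfI r0); rewrite -e1 mulrN -e0 sign_ordS sgS; ring.
Qed.

Lemma black_radius k : sin phi != 0 ->
  radius (csph c b) * g k = sg k * sin phi.
Proof.
move=> s0; have [n [a [nn a1 F]]] := tangent_frames.
have l0 j : sgradius n (N j) (T j) != 0.
  by rewrite -sqrf_eq0 (sgradius_sqr nn (F j)) subr_eq0.
have lS j : sgradius n (N (j + 1)) (T (j + 1)) = sgradius n (N j) (T j).
  apply: (closed_no_flip nn cs2 (F j) (F _) (F (j + 1 + 1)) (F (j + 1 + 1 + 1))
    (r_gt0 j) (r_gt0 _) (r_gt0 _) (r_gt0 _) (chord j) (chord _) (chord _)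
    (closing j) s0 (l0 j)).
have [s hs] := faceP.
have [x0 [_ x0M L0]] := hs k; have [x1 [x1M x1M' L1]] := hs (k + 1).
have [x2 [x2M _ L2]] := hs (k + 1 + 1).
(* Opposite faces around b carry the same choice of sign in N +- B. *)
have du : (-1) ^+ (s + (k + 1 + 1)%R)%N = (-1) ^+ (s + k)%N :> R.
  by rewrite !sign_ordS opprK.
have x02 : x0 - x2 = sg k *:
    ((r (k + 1 + 1))^-1 *: (Tp (k + 1) - Tp (k + 1 + 1))
     - (r (k + 1))^-1 *: (Tp k - Tp (k + 1))).
  transitivity ((x0 - M (k + 1)) - (x1 - M (k + 1)) + (x1 - M (k + 1 + 1))
    - (x2 - M (k + 1 + 1))).
    by apply/rowP => j; rewrite !mxE; ring.
  rewrite x0M x1M x1M' x2M !sgS.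
  move: (Tp _) (Tp _) (Tp _) => t2 t1 t0.
  by apply/rowP => j; rewrite !mxE; ring.
have l1 := lS k.
have l2 : sgradius n (N (k + 1 + 1)) (T (k + 1 + 1)) = sgradius n (N k) (T k).
  by rewrite !lS.
have det := lip_lcross_contact_points nn cs2 (F k) (F (k + 1)) (F (k + 1 + 1))
  (lt0r_neq0 (r_gt0 _)) (lt0r_neq0 (r_gt0 _)) (chord k) (chord (k + 1))
  (l0 k) l1 l2 (d2 s k).
have N02 := two_chords_neq (F k) (F (k + 1)) (F (k + 1 + 1)) (r_gt0 _) (r_gt0 _)
  (chord k) (chord (k + 1)) (l0 k) l1 l2.
have u02 : lip (u s k) (u s (k + 1 + 1)) != 0.
  rewrite /u du.
  exact: (lip_dir_neq0 nn cs2 (d2 s k) (F k) (F (k + 1 + 1)) l2 N02).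
have c0 := contactP (incident_black b k) L0.
have c2 := contactP (incident_black b (k + 1 + 1)) L2.
have detE : lip (lcross (x0 - x2) (u s k)) (u s (k + 1 + 1))
    = sg k * (2 * sin phi * lip (u s k) (u s (k + 1 + 1))).
  rewrite x02 lcrossZl lipZl /u du; congr (_ * _); exact: det.
move: detE.
have -> : x0 - x2 = (x0 - centre (csph c b)) - (x2 - centre (csph c b)).
  by apply/rowP => j; rewrite !mxE; ring.
(* Swapping arguments in the second determinant makes its contact equation applicable. The line
   signs at opposite faces agree, so the two terms add up, which produces the factor 2. *)
rewrite lcrossDl lcrossNl lipDl lipNl c0 [X in _ - X]lip_lcross_swap c2.
rewrite !lipZl (lipC (u s (k + 1 + 1))) !line_signS opprK.
move: u02; move: (lip _ _) => D D0 e.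
apply: (mulIf D0); have : 2 != 0 :> R by rewrite pnatr_eq0.
move/mulfI; apply; rewrite opprK in e.
by transitivity (sg k * (2 * sin phi * D)); [rewrite -e; ring | ring].
Qed.

End AssociatedCongruences.

(** * Constancy of the black radii, and the offset congruence *)

Section Offset.
Variable R : realType.

Lemma black_radius_const (h : snet R) phi hphi (c : congruence R) :
  Koebe h -> associated_member h phi hphi ->
  associated_congruence h phi hphi c ->
  forall b, black b -> radius (csph c b) = radius (csph c 0).
Proof.
move=> K A G.
have [s0|s0] := eqVneq (sin phi) 0.
  have z b : black b -> radius (csph c b) = 0.
    case: G => _ _ + _ bb => /(_ b bb).
    by rewrite s0 normr0 => /eqP; rewrite normr_eq0 => /eqP.
  by move=> b bb; rewrite !z.
(* The two black vertices of a face see the same line, and indices of equal parity give the same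
   edge sign. *)
have share b b' k k' : black b -> black b' -> bface b' k' = bface b k ->
    odd k' = odd k -> radius (csph c b') = radius (csph c b).
  move=> bb bb' ff kk.
  have g0 : Num.sg (ldir (cline c (bface b k)) 0 2) != 0.
    by rewrite sgr_eq0 (isotropic_neq0 (@ldir_neq0 _ _) (ldir_isotropic _)).
  apply: (mulIf g0); rewrite -{1}ff (black_radius K A G bb' k' s0).
  rewrite (black_radius K A G bb k s0) !edge_sign_bwhite; congr (_ * _).
  by rewrite -signr_odd -[RHS]signr_odd /= kk.
apply: const_on_black => b bb.
  apply: (share _ _ 0 2) => //; last by rewrite /bface -addrA.
  by move: bb; rewrite /black /=; lia.
apply: (share _ _ 1 3) => //; last by rewrite /bface -addrA.
by move: bb; rewrite /black /=; lia.
Qed.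

Definition offset_congruence (c : congruence R) (r : R) : congruence R :=
  Congruence
    (fun v => OSphere (centre (csph c v)) (radius (csph c v) - r))
    (fun f => let l := cline c f in
       OLine (lpoint l - r *: nu (ldir l)) (@ldir_neq0 _ l) (ldir_isotropic l)).

Lemma offset_contact c r :
  contact_congruence c -> contact_congruence (offset_congruence c r).
Proof.
move=> cc v f vf; have [t e] := cc v f vf; exists t => /=.
rewrite addrAC e; move: (nu _) => w.
by apply/rowP => j; rewrite !mxE; ring.
Qed.

End Offset.

Theorem corollary10p5 (R : realType) (h : snet R) (phi : R)
    (hphi : vertex -> osphere R) (c : congruence R) :
  Koebe h ->
  associated_member h phi hphi ->
  associated_congruence h phi hphi c ->
  exists cdot : congruence R,
    null_congruence cdot /\ center_net cdot = center_net c.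
Proof.
move=> K A G; have [cc cw cb _] := G; have [_ hr _] := A.
have rb := black_radius_const K A G.
exists (offset_congruence c (radius (csph c 0))); split=> //; split.
- exact: offset_contact.
- move=> w ww; rewrite /timelike /= cw// => /eqP; rewrite subr_eq0 => /eqP e.
  have : 1 < `|radius (hphi w)|.
    rewrite hr// invf_gt1 ?hradius_lt1//.
    by case: K => Si _ _ _; apply: hradius_gt0.
  by rewrite e (cb 0)// ltNge ler_norml sin_geN1 sin_le1.
- by move=> b bb; rewrite /null_sphere /= rb// subrr.
Qed.
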